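(* Let $S$ be a finite Kleene relation algebra satisfying the Tarski rule, let $p \in S$ be a forest and let $x \in S$ be a point. Consider the program (with program variable $y$ ranging over $S$) $y := x$; while $y \neq p^T\cdot y$ do $y := p^T \cdot y$ od. Then this program terminates, and in its final state $y$ is a point and $y = ((p^T)^*\cdot x) \sqcap ((p\sqcap 1)\cdot\top)$.
   Context: A Kleene relation algebra is a structure $(S,\sqcup,\sqcap,\cdot,\overline{\phantom{x}},{}^T,{}^*,\bot,\top,1)$ such that $(S,\sqcup,\sqcap,\overline{\phantom{x}},\bot,\top)$ is a Boolean algebra with order $x \sqsubseteq y \iff x \sqcup y = y$; $(S,\sqcup,\cdot,\bot,1)$ is an idempotent semiring ($\cdot$ associative with two-sided unit $1$, distributing over $\sqcup$, $\bot$ a two-sided zero of $\cdot$); transposition satisfies $(x\sqcup y)^T = x^T \sqcup y^T$, $(x^T)^T = x$, $(x\cdot y)^T = y^T\cdot x^T$ and $(x\cdot y)\sqcap z \sqsubseteq x\cdot(y\sqcap(x^T\cdot z))$; and the star satisfies $1\sqcup y\cdot y^* = y^* = 1 \sqcup y^*\cdot y$, $z\sqcup y\cdot x\sqsubseteq x \Rightarrow y^*\cdot z\sqsubseteq x$, $z \sqcup x\cdot y \sqsubseteq x \Rightarrow z\cdot y^*\sqsubseteq x$. The Tarski rule states $\top\cdot x\cdot\top = \top$ for every $x \neq \bot$. Write $x^+ = x\cdot x^*$. An element $x$ is univalent if $x^T x\sqsubseteq 1$, total if $1\sqsubseteq x x^T$, a mapping if univalent and total, injective if $x x^T\sqsubseteq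 1$, surjective if $1\sqsubseteq x^T x$, a vector if $x\cdot\top = x$, a point if it is an injective surjective vector, acyclic if $x^+\sqsubseteq\overline 1$, and a forest if it is a mapping and $x\sqcap\overline{1}$ is acyclic. Programs are sequential while-programs with the usual semantics: assignments evaluate their right-hand side in the current state; $p^T\cdot y$ is the value of the parent array $p$ at node $y$. *)

(* Defs.v *)
From HB Require Import structures.
From mathcomp Require Import all_boot all_order.

Set Implicit Arguments.
Unset Strict Implicit.
Unset Printing Implicit Defensive.

Import Order.TTheory.
Local Open Scope order_scope.

Declare Scope kra_scope.
Delimit Scope kra_scope with kra.

(* The Boolean algebra is MathComp's [ctbDistrLatticeType] (complemented
   distributive lattice with bottom and top); its order satisfies
   [x <= y <-> x `|` y = y] ([leEjoin]).  Associativity, commutativity and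
   idempotence of [`|`] with neutral element [\bot], the additive part of the
   idempotent semiring, come with that structure. *)
HB.mixin Record isKleeneRelAlg (d : Order.disp_t) S
    of Order.CTBDistrLattice d S := {
  kmul : S -> S -> S;
  kone : S;
  ktr : S -> S;
  kstar : S -> S;
  kmulA : forall x y z : S, kmul x (kmul y z) = kmul (kmul x y) z;
  kmul1l : forall x : S, kmul kone x = x;
  kmul1r : forall x : S, kmul x kone = x;
  kmulUl : forall x y z : S, kmul (x `|` y) z = kmul x z `|` kmul y z;
  kmulUr : forall x y z : S, kmul x (y `|` z) = kmul x y `|` kmul x z;
  kmul0l : forall x : S, kmul \bot x = \bot;
  kmul0r : forall x : S, kmul x \bot = \bot;
  ktrU : forall x y : S, ktr (x `|` y) = ktr x `|` ktr y;
  ktrK : forall x : S, ktr (ktr x) = x;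
  ktrM : forall x y : S, ktr (kmul x y) = kmul (ktr y) (ktr x);
  kdedekind : forall x y z : S,
    kmul x y `&` z <= kmul x (y `&` kmul (ktr x) z);
  kstar_unfoldl : forall y : S, kone `|` kmul y (kstar y) = kstar y;
  kstar_unfoldr : forall y : S, kone `|` kmul (kstar y) y = kstar y;
  kstar_inductl : forall x y z : S,
    z `|` kmul y x <= x -> kmul (kstar y) z <= x;
  kstar_inductr : forall x y z : S,
    z `|` kmul x y <= x -> kmul z (kstar y) <= x
}.

#[short(type="kleeneRelAlgType")]
HB.structure Definition KleeneRelAlg (d : Order.disp_t) :=
  { S of isKleeneRelAlg d S & Order.CTBDistrLattice d S }.

#[short(type="finKleeneRelAlgType")]
HB.structure Definition FinKleeneRelAlg (d : Order.disp_t) :=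
  { S of KleeneRelAlg d S & Finite S }.

Notation "x * y" := (kmul x y) : kra_scope.
Notation "1" := kone : kra_scope.
Notation "x ^T" := (ktr x) (format "x ^T") : kra_scope.
Notation "x ^*" := (kstar x) : kra_scope.

Local Open Scope kra_scope.

Section Elements.
Context {d : Order.disp_t} {S : kleeneRelAlgType d}.
Implicit Type x : S.

Definition kplus x : S := x * x^*.

Definition kunivalent x : Prop := x^T * x <= 1.
Definition ktotal x : Prop := 1 <= x * x^T.
Definition kmapping x : Prop := kunivalent x /\ ktotal x.
Definition kinjective x : Prop := x * x^T <= 1.
Definition ksurjective x : Prop := 1 <= x^T * x.
Definition kvector x : Prop := x * \top = x.
Definition kpoint x : Prop := [/\ kinjective x, ksurjective x & kvector x].
Definition kacyclic x : Prop := kplus x <= ~` 1.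
Definition kforest x : Prop := kmapping x /\ kacyclic (x `&` ~` 1).

End Elements.

Definition Tarski_rule {d : Order.disp_t} (S : kleeneRelAlgType d) : Prop :=
  forall x : S, x <> \bot -> \top * x * \top = \top.

(* While-programs over variables [V] with values in [A].  Expressions and tests
   are shallowly embedded as functions of the store. *)
Section WhilePrograms.
Context {V : eqType} {A : Type}.

Definition store : Type := V -> A.

Definition update (s : store) (v : V) (a : A) : store :=
  fun w => if w == v then a else s w.

Inductive cmd : Type :=
| Skip
| Assign (v : V) (e : store -> A)
| Seq (c1 c2 : cmd)
| If (b : store -> bool) (c1 c2 : cmd)
| While (b : store -> bool) (c : cmd).

(* [exec c s t]: started in [s], the program [c] terminates in state [t]. *)
Inductive exec : cmd -> store -> store -> Prop :=
| exec_skip s : exec Skip s s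
| exec_assign v e s : exec (Assign v e) s (update s v (e s))
| exec_seq c1 c2 s1 s2 s3 :
    exec c1 s1 s2 -> exec c2 s2 s3 -> exec (Seq c1 c2) s1 s3
| exec_if_true (b : store -> bool) c1 c2 s t :
    b s -> exec c1 s t -> exec (If b c1 c2) s t
| exec_if_false (b : store -> bool) c1 c2 s t :
    ~~ b s -> exec c2 s t -> exec (If b c1 c2) s t
| exec_while_false (b : store -> bool) c s : ~~ b s -> exec (While b c) s s
| exec_while_true (b : store -> bool) c s1 s2 s3 :
    b s1 -> exec c s1 s2 -> exec (While b c) s2 s3 -> exec (While b c) s1 s3.

(* Execution is deterministic, so having a final state is the same as the
   absence of infinite executions. *)
Lemma exec_det c s t1 t2 : exec c s t1 -> exec c s t2 -> t1 = t2.
Proof.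
have absurd (b : bool) : b -> ~~ b -> False by case: b.
move=> e1; elim: e1 t2 => {c s t1}.
- by move=> s t2 e; inversion e.
- by move=> v e s t2 e2; inversion e2.
- move=> c1 c2 s1 s2 s3 _ IH1 _ IH2 t2 e; inversion e; subst.
  by apply: IH2; rewrite (IH1 _ ltac:(eassumption)).
- move=> b c1 c2 s t bs _ IH t2 e; inversion e; subst; first exact: IH.
  by exfalso; eauto.
- move=> b c1 c2 s t bs _ IH t2 e; inversion e; subst; last exact: IH.
  by exfalso; eauto.
- move=> b c s bs t2 e; inversion e; subst => //.
  by exfalso; eauto.
- move=> b c s1 s2 s3 bs _ IH1 _ IH2 t2 e; inversion e; subst.
    by exfalso; eauto.
  by apply: IH2; rewrite (IH1 _ ltac:(eassumption)).
Qed.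

Definition terminates (c : cmd) (s : store) : Prop := exists t, exec c s t.

End WhilePrograms.

Arguments store : clear implicits.
Arguments cmd : clear implicits.

(* Main.v *)
Require Import Defs.
From HB Require Import structures.
From mathcomp Require Import all_boot all_order.

(** Every iterate of [x] under [p^T] is a point, and by the Tarski rule two
    points are equal or disjoint.  So while [y <> p^T * y], the node [y] is not
    a root, and the step to [p^T * y] only uses the acyclic part [p `&` ~` 1];
    the set of ancestors of [y] strictly shrinks, which gives termination in a
    finite algebra, while the set of roots reachable from [y] is invariant.  At
    the end [y = p^T * y], and this set is [y] itself. *)

Set Implicit Arguments.
Unset Strict Implicit.
Unset Printing Implicit Defensive.

Import Order.TTheory Order.CTheory.
Local Open Scope order_scope.
Local Open Scope kra_scope.

Section RelationAlgebra.
Context {d : Order.disp_t} {S : kleeneRelAlgType d}.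
Implicit Types x y z p t : S.

Lemma kmul_lel x y z : x <= y -> x * z <= y * z.
Proof. by rewrite !leEjoin -kmulUl => /eqP->. Qed.

Lemma kmul_ler x y z : x <= y -> z * x <= z * y.
Proof. by rewrite !leEjoin -kmulUr => /eqP->. Qed.

Lemma ktr_le x y : x <= y -> x^T <= y^T.
Proof. by rewrite !leEjoin -ktrU => /eqP->. Qed.

Lemma ktr1 : (1 : S)^T = 1.
Proof. by have := ktrM (1 : S) (1^T); rewrite ktrK !kmul1l ktrK. Qed.

Lemma ktr0 : (\bot : S)^T = \bot.
Proof.
by apply: le_anti; rewrite le0x andbT -[leRHS]ktrK ktr_le ?le0x.
Qed.

Lemma ktrT : (\top : S)^T = \top.
Proof.
by apply: le_anti; rewrite lex1 -[leLHS]ktrK ktr_le ?lex1.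
Qed.

(** The Dedekind rule with [1] as its other arguments gives [t <= t * t^T], and the left factor is
    below [1]. Transposing yields the converse, so subidentities are symmetric. *)
Lemma subid_le_tr t : t <= 1 -> t <= t^T.
Proof.
move=> t1; have := kdedekind t 1 1; rewrite !kmul1r => h.
have {1}-> : t = t `&` 1 by apply/esym/meet_idPl.
apply: le_trans h _; apply: (le_trans (kmul_ler _ (leIr _ _))).
by apply: (le_trans (kmul_lel _ t1)); rewrite kmul1l.
Qed.

Lemma kstar_ge1 y : 1 <= y^*.
Proof. by rewrite -kstar_unfoldl leUl. Qed.

Lemma kvectorI x y : kvector x -> kvector y -> kvector (x `&` y).
Proof.
move=> vx vy; apply: le_anti; apply/andP; split.
  by rewrite lexI -{2}vx -{3}vy !kmul_lel ?leIl ?leIr.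
by rewrite -[leLHS]kmul1r kmul_ler ?lex1.
Qed.

Lemma kmul_mapping_point p y : kmapping p -> kpoint y -> kpoint (p^T * y).
Proof.
move=> [pu pt] [yi ys yv]; split.
- rewrite /kinjective ktrM ktrK kmulA -(kmulA _ y).
  apply: le_trans pu; apply: kmul_lel.
  by rewrite -[leRHS]kmul1r; apply: kmul_ler.
- rewrite /ksurjective ktrM ktrK kmulA -(kmulA _ p).
  apply: (le_trans ys); apply: kmul_lel.
  by rewrite -[leLHS]kmul1r; apply: kmul_ler.
- by rewrite /kvector -kmulA yv.
Qed.

(** The Tarski rule makes [\top * z], hence [z^T * \top], equal to [\top]; the Dedekind rule then
    bounds [1] by [z^T * z]. *)
Lemma tarski_vector_surjective z :
  Tarski_rule S -> kvector z -> z <> \bot -> ksurjective z.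
Proof.
move=> tarski zv /tarski; rewrite -kmulA zv => zT; have := kdedekind (z^T) \top 1.
rewrite ktrK kmul1r -{1}ktrT -ktrM zT ktrT !meet1x; exact: id.
Qed.

Lemma kpoint_disjoint x y :
  Tarski_rule S -> kpoint x -> kpoint y -> x <> y -> x `&` y = \bot.
Proof.
move=> tarski px py xy; apply/eqP/negPn/negP => /eqP z0.
have zs : ksurjective (x `&` y).
  case: px py => [_ _ xv] [_ _ yv].
  by apply: tarski_vector_surjective => //; apply: kvectorI.
(* With [z] the meet of [x] and [y]: [u <= u * z^T * z <= u * u^T * z <= z]. Hence both points equal
   [z]. *)
have le_meet u : kinjective u -> x `&` y <= u -> u <= x `&` y.
  move=> ui zu; rewrite -[leLHS]kmul1r.
  apply: (le_trans (kmul_ler _ zs)); rewrite kmulA.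
  rewrite -[leRHS]kmul1l; apply: kmul_lel.
  by apply: le_trans ui; apply/kmul_ler/ktr_le.
case: px py => [xi _ _] [yi _ _]; apply: xy; apply: le_anti.
have := le_meet x xi (leIl _ _); have := le_meet y yi (leIr _ _).
by rewrite !lexI => /andP[-> _] /andP[_ ->].
Qed.

Lemma loop_le p y : (p `&` 1) * y <= y `&` (p^T * y).
Proof.
have t1 : p `&` 1 <= 1 by apply: leIr.
rewrite lexI -{2}[y]kmul1l !kmul_lel //.
exact: le_trans (subid_le_tr t1) (ktr_le (leIl _ _)).
Qed.

(** With [t] the loop part of [p], [t * \top] is the vector of roots; by the Dedekind rule it meets
    [y] below [t * (t^T * y) <= t * y], which [loop_le] bounds. *)
Lemma nonroot_disjoint p y :
  y `&` (p^T * y) = \bot -> y `&` ((p `&` 1) * \top) = \bot.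
Proof.
move=> y0; apply/eqP; rewrite -lex0 meetC.
apply: (le_trans (kdedekind _ _ _)); rewrite meet1x.
set t := p `&` 1; have t1 : t <= 1 by apply: leIr.
rewrite -y0; apply: le_trans (loop_le p y); apply: kmul_ler.
by rewrite -[leRHS]kmul1l -ktr1; apply/kmul_lel/ktr_le.
Qed.

Lemma nonroot_step p y : y `&` (p^T * y) = \bot ->
  (p^T * y)^T = y^T * (p `&` ~` 1).
Proof.
move=> y0; rewrite ktrM ktrK.
have {1}-> : p = (p `&` 1) `|` (p `&` ~` 1) by rewrite -meetUr joinxC meetx1.
rewrite kmulUr; suff -> : y^T * (p `&` 1) = \bot by rewrite join0x.
rewrite -[LHS]ktrK ktrM ktrK -ktr0; congr (_^T).
apply/eqP; rewrite -lex0 -y0; apply: le_trans (loop_le p y).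
by apply: kmul_lel; rewrite -[leRHS]ktrK; apply/ktr_le/subid_le_tr/leIr.
Qed.

(** Here [y * y^T] lies below both [1] and [kplus p], so it is [\bot], and surjectivity collapses
    [1] to [\bot]. The conclusion is not [False] because the one-element algebra is allowed. *)
Lemma acyclic_point p y : kacyclic p -> kpoint y ->
  y^T <= y^T * kplus p -> (\bot : S) = \top.
Proof.
move=> pa [yi ys yv] yp.
have yy0 : y * y^T = \bot.
  apply/eqP; rewrite -lex0 -(meetxC 1) lexI yi /=.
  apply: (le_trans (kmul_ler y yp)); rewrite kmulA; apply: le_trans pa.
  by rewrite -[leRHS]kmul1l; apply: kmul_lel.
have y0 : y = \bot.
  apply/eqP; rewrite -lex0 -(kmul0l y) -yy0 -kmulA -[leLHS]kmul1r.
  exact: kmul_ler.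
move: ys; rewrite /ksurjective {2}y0 kmul0r lex0 => /eqP one0.
by rewrite -[RHS]kmul1l one0 kmul0l.
Qed.

Lemma ancestors_lt p y : kacyclic (p `&` ~` 1) -> kpoint y ->
    y <> p^T * y -> y `&` (p^T * y) = \bot ->
  (p^T * y)^T * (p `&` ~` 1)^* < y^T * (p `&` ~` 1)^*.
Proof.
move=> pa py ny y0; rewrite nonroot_step // -kmulA.
rewrite lt_def; apply/andP; split; last first.
  by apply: kmul_ler; rewrite -[leRHS]kstar_unfoldl leUr.
(* Equality would make [y] its own proper ancestor. *)
apply/negP => /eqP e.
have bt : (\bot : S) = \top.
  apply: (acyclic_point pa py); rewrite /kplus -e -{1}[y^T]kmul1r.
  exact/kmul_ler/kstar_ge1.
have all0 z : z = \bot by apply/eqP; rewrite -lex0 bt lex1.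
by apply: ny; rewrite [LHS]all0 [RHS]all0.
Qed.

(** Unfolding the star on the right splits off [y] itself, which contains no root. *)
Lemma reachable_roots_step p y : y `&` (p^T * y) = \bot ->
  ((p^T)^* * (p^T * y)) `&` ((p `&` 1) * \top) =
  ((p^T)^* * y) `&` ((p `&` 1) * \top).
Proof.
move=> /nonroot_disjoint y0.
by rewrite -[in RHS]kstar_unfoldr kmulUl kmul1l meetUl y0 join0x kmulA.
Qed.

Lemma reachable_roots_fix p y : kpoint y -> y = p^T * y ->
  y = ((p^T)^* * y) `&` ((p `&` 1) * \top).
Proof.
move=> [yi ys yv] yE; apply: le_anti; apply/andP; split.
  rewrite lexI; apply/andP; split.
    by rewrite -{1}[y]kmul1l; apply/kmul_lel/kstar_ge1.
  (* Since [y * y^T] is symmetric and [y = p^T * y], it lies below [p^T] and therefore below [p]. *)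
  have yp : y * y^T <= p `&` 1.
    rewrite lexI yi andbT -[leLHS]ktrK -[leRHS]ktrK; apply: ktr_le.
    rewrite ktrM ktrK {1}yE -kmulA -[leRHS]kmul1r; exact: kmul_ler.
  rewrite -[leLHS]kmul1r; apply: (le_trans (kmul_ler y ys)).
  rewrite kmulA; apply: (le_trans (kmul_lel y yp)).
  exact/kmul_ler/lex1.
apply: (le_trans (leIl _ _)); apply: kstar_inductl.
by rewrite -yE joinxx.
Qed.

End RelationAlgebra.

Lemma card_down_set_lt {d : Order.disp_t} {S : finPOrderType d} (u v : S) :
  u < v -> (#|[set z : S | (z <= u)%O]| < #|[set z : S | (z <= v)%O]|)%N.
Proof.
move=> uv; apply/proper_card/properP; split.
  by apply/subsetP => z; rewrite !inE => /le_trans; apply; apply: ltW.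
by exists v; rewrite !inE // lt_geF.
Qed.

Lemma root_loop_exec (d : Order.disp_t) (S : finKleeneRelAlgType d)
    (p : S) (V : eqType) (y : V) (s : store V S) :
  Tarski_rule S -> kforest p -> kpoint (s y) ->
  exists t : store V S,
    [/\ exec (While (fun s => s y != p^T * s y)
                    (Assign y (fun s => p^T * s y))) s t,
        kpoint (t y) &
        t y = ((p^T)^* * s y) `&` ((p `&` 1) * \top)].
Proof.
move=> tarski [pm pa].
(* The variant counts the elements below the row vector of ancestors of the current node. *)
have [n] := ubnP #|[set z : S | z <= (s y)^T * (p `&` ~` 1)^*]|.
elim: n s => // n IHn s sn py.
have [yE | /eqP ny] := eqVneq (s y) (p^T * s y).
  exists s; split=> //; last exact: reachable_roots_fix.
  by apply: exec_while_false; rewrite negbK; apply/eqP.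
have pqy := kmul_mapping_point pm py.
have y0 := kpoint_disjoint tarski py pqy ny.
pose s' : store V S := update s y (p^T * s y).
have s'y : s' y = p^T * s y by rewrite /s' /update eqxx.
have [||t [st pt tE]] := IHn s'.
- rewrite s'y -ltnS; apply: leq_trans sn; rewrite ltnS.
  exact/card_down_set_lt/ancestors_lt.
- by rewrite s'y.
exists t; split=> //; last by rewrite tE s'y reachable_roots_step.
apply: exec_while_true st; first exact/eqP.
exact: (@exec_assign V S y (fun s => p^T * s y)).
Qed.

Theorem mainTheorem16 (d : Order.disp_t) (S : finKleeneRelAlgType d)
    (tarski : Tarski_rule S) (p x : S) (p_forest : kforest p)
    (x_point : kpoint x) (V : eqType) (y : V) :
  let prog : cmd V S :=
    Seq (Assign y (fun _ => x))
        (While (fun s => s y != p^T * s y)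
               (Assign y (fun s => p^T * s y))) in
  forall s : store V S,
    terminates prog s /\
    (forall t : store V S, exec prog s t ->
       kpoint (t y) /\
       t y = ((p^T)^* * x) `&` ((p `&` 1) * \top)).
Proof.
move=> prog s; pose s0 : store V S := update s y x.
have s0y : s0 y = x by rewrite /s0 /update eqxx.
have [|t [st pt]] := @root_loop_exec d S p V y s0 tarski p_forest.
  by rewrite s0y.
rewrite s0y => tE.
have et : exec prog s t.
  by apply: exec_seq st; apply: (@exec_assign V S y (fun _ => x)).
(* By determinism, the one run constructed settles every final state. *)
by split; [exists t | move=> t' /(exec_det et) <-].
Qed.
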